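(* For every $M\ge 2$ there exists an SPQN over the edge variables $\mathbf E$ of graphs on $M$ vertices, of size $O(M^4)$, which is conditionally complete, conditionally decomposable and conditionally sound, and whose output $\Psi$ restricted to $\{0,1\}^N$ equals a strictly positive distribution on triangle-free graphs on $M$ vertices. Moreover, if one restricts to SPQNs composed entirely of valid CMO nodes, there exist such SPQNs of size $O(M^4)$ whose outputs approximate a strictly positive distribution on triangle-free graphs on $M$ vertices arbitrarily well (i.e. a sequence of them, each of size $O(M^4)$, converges pointwise on $\{0,1\}^N$ to such a distribution).
   Context: Edge variables: $\mathbf E=\{E_{ij}:1\le i<j\le M\}$ binary, $N=\binom M2$; $E_{ij}=1$ means edge $\{i,j\}$ is present. A graph contains a triangle iff there exist $i_1<i_2<i_3$ with $E_{i_1i_2}=E_{i_2i_3}=E_{i_1i_3}=1$. A probability function $d$ on $\{0,1\}^N$ is a strictly positive distribution on triangle-free graphs if $d(\mathbf E)>0$ exactly when the encoded graph is triangle-free. An SPQN over binary variables is a rooted DAG evaluated on $\{0,1,*\}^N$ with leaves $\mathbb 1[x_i=a]$ (value $1$ if $x_i=*$), sum nodes (weighted sums with strictly positive weights summing to $1$), product nodes, and quotient nodes $v$ with two children $\mathrm{num}(v),\mathrm{den}(v)$ computing $\Psi_{\mathrm{num}(v)}/\Psi_{\mathrm{den}(v)}$. Its size is the number of internal nodes. Scope: $\mathrm{sc}(v)=\{i\}$ for a leaf of variable $i$, else the union of children's scopes. Effective scope: $\{i\}$ for a leaf; union of children's effective scopes for sum/product nodes; $\mathrm{eff}(\mathrm{num}(v))\setminus\mathrm{eff}(\mathrm{den}(v))$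 for quotient nodes. $\mathrm{cond}(v)=\mathrm{sc}(v)\setminus\mathrm{eff}(v)$. Conditionally complete: children of each sum node have equal effective scopes. Conditionally decomposable: for each product node, distinct children have disjoint effective scopes and the directed graph on its children with edges $c'\to c''$ whenever $\mathrm{eff}(c')\cap\mathrm{cond}(c'')\ne\emptyset$ is acyclic. Conditionally sound: for each quotient node $v$, $\Psi_{\mathrm{den}(v)}$ is strictly positive, $\mathrm{cond}(\mathrm{den}(v))\subseteq\mathrm{cond}(\mathrm{num}(v))$, $\mathrm{eff}(\mathrm{den}(v))\subseteq\mathrm{eff}(\mathrm{num}(v))$, and $\Psi_{\mathrm{den}(v)}(\mathbf a)=\sum_{\mathbf z}\Psi_{\mathrm{num}(v)}(\mathbf z)$ for all $\mathbf a\in\{0,1,*\}^N$, summing over $\mathbf z$ with $z_i=a_i$ for $i\notin\mathrm{eff}(v)$ and $z_i\in\{0,1\}$ for $i\in\mathrm{eff}(v)$. CMO node: given $\alpha\ge0,\beta>0,\gamma\ge1$, strictly positive weights $\mathbf w$ summing to $1$, and children $a_{ij}$ ($i\le\gamma,j\le\alpha$), $b_{ij}$ ($i\le\gamma,j\le\beta$), it is a quotient node computing $\frac{\sum_i w_i(\prod_jA_{ij})(\prod_jB_{ij})}{\sum_i w_i\prod_jA_{ij}}$ with $A_{ij}=\Psi_{a_{ij}}$, $B_{ij}=\Psi_{b_{ij}}$, built from internal product nodes $P^A_i=\prod_jA_{ij}$, $P^B_i=\prod_jB_{ij}$, $p_i=P^A_iP^B_i$ and internal sum nodes (weights $\mathbf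 w$) over the $p_i$ (numerator) and over the $P^A_i$ (denominator). It is valid if: (1) its children are valid CMO nodes, or $\alpha=0,\beta=1,\gamma=2$ and its children are exactly $\mathbb 1[x_i=0],\mathbb 1[x_i=1]$ for some $i$; (2) its internal sum nodes are conditionally complete; (3) its internal product nodes are conditionally decomposable and in the dependency graph of each $p_i$ there is no edge from $P^B_i$ to $P^A_i$; (4) $\mathrm{eff}(P^B_{i_1})=\mathrm{eff}(P^B_{i_2})$ for all $i_1,i_2$. An SPQN is composed of valid CMO nodes if its root is a valid CMO node. *)

(* Defs.v *)
From Stdlib Require Import Reals.
From mathcomp Require Import all_boot.

Set Implicit Arguments.
Unset Strict Implicit.
Unset Printing Implicit Defensive.

(* SPQNs as rooted DAGs, given as a topologically ordered list of nodes.     *)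
(* Node number k of [net] is [nth _ net k]; children are referred to by      *)
(* their index, which must be smaller than k.  The root is the last node.    *)

Inductive node (V : Type) : Type :=
| Leaf of V & bool                (* indicator 1[x = a] (value 1 if x = * ) *)
| SumN of seq (R * nat)
| ProdN of seq nat
| QuotN of nat & nat.

Arguments Leaf {V}.
Arguments SumN {V}.
Arguments ProdN {V}.
Arguments QuotN {V}.

Definition children V (n : node V) : seq nat :=
  match n with
  | Leaf _ _ => [::]
  | SumN ch => map snd ch
  | ProdN ch => ch
  | QuotN a b => [:: a; b]
  end.

Definition is_internal V (n : node V) : bool :=
  if n is Leaf _ _ then false else true.

Section SPQN.
Variable V : finType.

(* partial assignments in {0,1,*}^V : None stands for * *)
Definition passign := V -> option bool.

Record info := Info { ival : passign -> R; isc : {set V}; ieff : {set V} }.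

Definition dinfo : info := Info (fun _ => R0) set0 set0.

Definition leaf_val (x : V) (a : bool) (z : passign) : R :=
  match z x with None => R1 | Some b => if b == a then R1 else R0 end.

Definition node_info (acc : seq info) (n : node V) : info :=
  let look k := nth dinfo acc k in
  match n with
  | Leaf x a => Info (leaf_val x a) [set x] [set x]
  | SumN ch =>
      Info (fun z => \big[Rplus/R0]_(p <- ch) Rmult p.1 (ival (look p.2) z))
           (\bigcup_(p <- ch) isc (look p.2))
           (\bigcup_(p <- ch) ieff (look p.2))
  | ProdN ch =>
      Info (fun z => \big[Rmult/R1]_(c <- ch) ival (look c) z)
           (\bigcup_(c <- ch) isc (look c))
           (\bigcup_(c <- ch) ieff (look c))
  | QuotN nu de =>
      Info (fun z => Rdiv (ival (look nu) z) (ival (look de) z))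
           (isc (look nu) :|: isc (look de))
           (ieff (look nu) :\: ieff (look de))
  end.

Definition infos (net : seq (node V)) : seq info :=
  foldl (fun acc n => rcons acc (node_info acc n)) [::] net.

Definition nnode (net : seq (node V)) (k : nat) : node V := nth (ProdN [::]) net k.
Definition ninfo (net : seq (node V)) (k : nat) : info := nth dinfo (infos net) k.
Definition nval net k := ival (ninfo net k).
Definition nsc net k := isc (ninfo net k).
Definition neff net k := ieff (ninfo net k).
Definition ncond net k := nsc net k :\: neff net k.

Definition root (net : seq (node V)) : nat := (size net).-1.

Definition Psi (net : seq (node V)) : passign -> R := nval net (root net).

Definition spqn_size (net : seq (node V)) : nat := count (@is_internal V) net.

Definition spqn_wf (net : seq (node V)) : Prop :=
  net <> [::] /\
  forall k, k < size net ->
    (forall c, c \in children (nnode net k) -> c < k) /\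
    (forall ch, nnode net k = SumN ch ->
       (forall p, List.In p ch -> Rlt R0 p.1) /\
       \big[Rplus/R0]_(p <- ch) p.1 = R1).

Definition sum_complete (net : seq (node V)) (k : nat) : Prop :=
  forall ch, nnode net k = SumN ch ->
    forall p q, List.In p ch -> List.In q ch -> neff net p.2 = neff net q.2.

Definition cond_complete net : Prop :=
  forall k, k < size net -> sum_complete net k.

Definition acyclic (T : finType) (e : rel T) : Prop :=
  forall x y, e x y -> ~~ connect e y x.

Definition dep_graph (net : seq (node V)) (ch : seq nat) : rel 'I_(size ch) :=
  fun i j => ~~ [disjoint neff net (nth 0 ch i) & ncond net (nth 0 ch j)].

Definition prod_decomp (net : seq (node V)) (k : nat) : Prop :=
  forall ch, nnode net k = ProdN ch ->
    (forall i j, i < size ch -> j < size ch -> i != j ->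
       [disjoint neff net (nth 0 ch i) & neff net (nth 0 ch j)]) /\
    acyclic (@dep_graph net ch).

Definition cond_decomposable net : Prop :=
  forall k, k < size net -> prod_decomp net k.

Definition sum_over (S : {set V}) (f : passign -> R) (a : passign) : R :=
  \big[Rplus/R0]_(b : {ffun V -> bool} | [forall x, (x \notin S) ==> ~~ b x])
     f (fun x => if x \in S then Some (b x) else a x).

Definition quot_sound (net : seq (node V)) (k : nat) : Prop :=
  forall nu de, nnode net k = QuotN nu de ->
    (forall a, Rlt R0 (nval net de a)) /\
    ncond net de \subset ncond net nu /\
    neff net de \subset neff net nu /\
    (forall a, nval net de a = sum_over (neff net k) (nval net nu) a).

Definition cond_sound net : Prop :=
  forall k, k < size net -> quot_sound net k.

Definition cmo_shape (net : seq (node V)) (k alpha beta gamma : nat) (w : seq R)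
    (nu de : nat) (p PA PB : seq nat) (a b : seq (seq nat)) : Prop :=
  0 < beta /\ 1 <= gamma /\
  size w = gamma /\ size p = gamma /\ size PA = gamma /\ size PB = gamma /\
  size a = gamma /\ size b = gamma /\
  (forall i, i < gamma -> size (nth [::] a i) = alpha /\ size (nth [::] b i) = beta) /\
  (forall x, List.In x w -> Rlt R0 x) /\ \big[Rplus/R0]_(x <- w) x = R1 /\
  nnode net k = QuotN nu de /\
  nnode net nu = SumN (zip w p) /\
  nnode net de = SumN (zip w PA) /\
  (forall i, i < gamma ->
     nnode net (nth 0 p i) = ProdN [:: nth 0 PA i; nth 0 PB i] /\
     nnode net (nth 0 PA i) = ProdN (nth [::] a i) /\
     nnode net (nth 0 PB i) = ProdN (nth [::] b i)).

Definition cmo_conds (net : seq (node V)) (gamma nu de : nat) (p PA PB : seq nat) : Prop :=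
  sum_complete net nu /\ sum_complete net de /\
  (forall i, i < gamma ->
     prod_decomp net (nth 0 PA i) /\ prod_decomp net (nth 0 PB i) /\
     prod_decomp net (nth 0 p i) /\
     (* no edge P^B_i -> P^A_i in the dependency graph of p_i *)
     [disjoint neff net (nth 0 PB i) & ncond net (nth 0 PA i)]) /\
  (forall i j, i < gamma -> j < gamma -> neff net (nth 0 PB i) = neff net (nth 0 PB j)).

Inductive valid_cmo (net : seq (node V)) : nat -> Prop :=
| VCmoRec k alpha beta gamma w nu de p PA PB a b :
    cmo_shape net k alpha beta gamma w nu de p PA PB a b ->
    cmo_conds net gamma nu de p PA PB ->
    (forall i j, i < gamma -> j < alpha -> valid_cmo net (nth 0 (nth [::] a i) j)) ->
    (forall i j, i < gamma -> j < beta -> valid_cmo net (nth 0 (nth [::] b i) j)) ->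
    valid_cmo net k
| VCmoBase k w nu de p PA PB a b (x : V) :
    cmo_shape net k 0 1 2 w nu de p PA PB a b ->
    cmo_conds net 2 nu de p PA PB ->
    ((nnode net (nth 0 (nth [::] b 0) 0) = Leaf x false /\
      nnode net (nth 0 (nth [::] b 1) 0) = Leaf x true) \/
     (nnode net (nth 0 (nth [::] b 0) 0) = Leaf x true /\
      nnode net (nth 0 (nth [::] b 1) 0) = Leaf x false)) ->
    valid_cmo net k.

Definition composed_of_cmo (net : seq (node V)) : Prop :=
  spqn_wf net /\ valid_cmo net (root net).

End SPQN.

Definition edge (M : nat) : finType := {p : 'I_M * 'I_M | p.1 < p.2}.

Definition adj M (E : {ffun edge M -> bool}) (i j : 'I_M) : bool :=
  [exists e : edge M, (val e == (i, j)) && E e].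

Definition has_triangle M (E : {ffun edge M -> bool}) : bool :=
  [exists i1 : 'I_M, exists i2 : 'I_M, exists i3 : 'I_M,
     [&& i1 < i2, i2 < i3, adj E i1 i2, adj E i2 i3 & adj E i1 i3]].

Definition triangle_free M (E : {ffun edge M -> bool}) : bool := ~~ has_triangle E.

Definition tf_distribution M (d : {ffun edge M -> bool} -> R) : Prop :=
  (forall E, Rle R0 (d E)) /\
  \big[Rplus/R0]_(E : {ffun edge M -> bool}) d E = R1 /\
  (forall E, Rlt R0 (d E) <-> triangle_free E).

(* Main.v *)
Require Import Defs.
From HB Require Import structures.
From Stdlib Require Import Reals Lra FunctionalExtensionality.
From mathcomp Require Import all_boot.

(** Order the edges by their smaller endpoint.  The distribution is the product
over the edges [(j, k)] of the conditional law of [E_jk] given the edges with a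
smaller first endpoint: 0 if some [i < j] has [E_ij = E_ik = 1], and a fair coin
otherwise.  Each conditional law is built by running through the candidates [i]
one at a time.  The node for the next [i] is a uniform mixture over
[(a, b) in {0,1}^2] whose gates [A] are the indicators of [E_ij = a] and
[E_ik = b], and whose mixed component [B] is the previous node, except for
[a = b = 1], where it is the indicator of [E_jk = 0].  A triangle thus costs
O(1) nodes.  On total assignments the denominator is the constant 1/4, so that
replacing the indicators by base CMO nodes with weights [1 - eps] and [eps]
makes the output a polynomial in [eps], and [eps -> 0] gives the limit. *)

Set Implicit Arguments.
Unset Strict Implicit.
Unset Printing Implicit Defensive.

Delimit Scope R_scope with Re.

(** * Real sums and products as big operators, and acyclicity from a rank *)

Lemma RplusA : associative Rplus. Proof. by move=> x y z; rewrite Rplus_assoc. Qed.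
Lemma RmultA : associative Rmult. Proof. by move=> x y z; rewrite Rmult_assoc. Qed.
HB.instance Definition _ :=
  Monoid.isComLaw.Build R R0 Rplus RplusA Rplus_comm Rplus_0_l.
HB.instance Definition _ :=
  Monoid.isComLaw.Build R R1 Rmult RmultA Rmult_comm Rmult_1_l.
HB.instance Definition _ := Monoid.isMulLaw.Build R R0 Rmult Rmult_0_l Rmult_0_r.
HB.instance Definition _ :=
  Monoid.isAddLaw.Build R Rmult Rplus Rmult_plus_distr_r Rmult_plus_distr_l.

Lemma prodR_gt0 (I : eqType) (s : seq I) (F : I -> R) :
  (forall i, i \in s -> (0 < F i)%Re) -> (0 < \big[Rmult/R1]_(i <- s) F i)%Re.
Proof.
move=> F_gt0; rewrite big_seq.
by elim/big_ind: _ => [|x y|i /F_gt0 //]; [exact: Rlt_0_1 | exact: Rmult_lt_0_compat].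
Qed.

Lemma in_bigcup_seq (V : finType) I (s : seq I) (F : I -> {set V}) x :
  (x \in \bigcup_(i <- s) F i) = has (fun i => x \in F i) s.
Proof. by elim: s => [|i s IH]; rewrite ?big_nil ?big_cons inE //= IH. Qed.

(** A path never lowers [r], so after an edge that raised it no path can lead back. Dependency
    graphs are shown acyclic through such a rank on the children. *)
Lemma acyclic_incr (T : finType) (e : rel T) (r : T -> nat) :
  (forall x y, e x y -> r x < r y) -> acyclic e.
Proof.
move=> e_incr x y /e_incr r_xy; apply/connectP=> -[p ep lp].
suff : r y <= r x by rewrite leqNgt r_xy.
rewrite lp; elim: p y ep {r_xy lp} => //= z p IH y /andP[/e_incr /ltnW yz ep].
exact: leq_trans yz (IH _ ep).
Qed.

(** * Networks and partial sums *)

Section Networks.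
Variable V : finType.
Implicit Types (net : seq (node V)) (z a : passign V) (S : {set V}).

Definition topological net :=
  forall k, k < size net -> forall c, c \in children (nnode net k) -> c < k.

Lemma node_info_eq acc acc' (n : node V) :
  (forall c, c \in children n -> nth (dinfo V) acc c = nth (dinfo V) acc' c) ->
  node_info acc n = node_info acc' n.
Proof.
case: n => [//|ch|ch|nu de] /= E.
- congr Info; [apply: functional_extensionality => z| |].
  + elim: ch E => [|p ch IH] E; rewrite ?big_nil // !big_cons E ?mem_head // IH // => c cP.
    by apply: E; rewrite inE cP orbT.
  + elim: ch E => [|p ch IH] E; rewrite ?big_nil // !big_cons E ?mem_head // IH // => c cP.
    by apply: E; rewrite inE cP orbT.
  elim: ch E => [|p ch IH] E; rewrite ?big_nil // !big_cons E ?mem_head // IH // => c cP.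
  by apply: E; rewrite inE cP orbT.
- congr Info; [apply: functional_extensionality => z| |];
  by apply: eq_big_seq => c /E ->.
by rewrite !E ?inE ?eqxx ?orbT.
Qed.

Lemma infos_rcons net n :
  infos (rcons net n) = rcons (infos net) (node_info (infos net) n).
Proof. by rewrite /infos -cats1 foldl_cat. Qed.

Lemma size_infos net : size (infos net) = size net.
Proof. by elim/last_ind: net => // net n IH; rewrite infos_rcons !size_rcons IH. Qed.

(** The fold computes a node from the prefix before it. In a topological order the children all lie
    in that prefix, so it may be replaced by the complete list, which turns the fold into a
    recursive equation. *)
Lemma ninfoE net k : topological net -> k < size net ->
  ninfo net k = node_info (infos net) (nnode net k).
Proof.
elim/last_ind: net k => // net n IH k topo; rewrite size_rcons ltnS => le_k.
have topo' : topological net.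
  move=> j lt_j c; have := topo j _ c; rewrite size_rcons ltnS (ltnW lt_j) => /(_ isT).
  by rewrite /nnode nth_rcons lt_j.
have ch_lt c : c \in children (nnode (rcons net n) k) -> c < k.
  by apply: topo; rewrite size_rcons ltnS.
transitivity (node_info (infos net) (nnode (rcons net n) k)); last first.
  apply: node_info_eq => c /ch_lt lt_c.
  by rewrite infos_rcons nth_rcons size_infos (leq_trans lt_c le_k).
rewrite /ninfo infos_rcons nth_rcons size_infos.
move: le_k; rewrite leq_eqVlt => /orP[/eqP->|lt_k].
  by rewrite ltnn eqxx /nnode nth_rcons ltnn eqxx.
by rewrite lt_k /nnode nth_rcons lt_k; apply: IH.
Qed.

(** Only leaves read the assignment, and the scope collects their variables. This is what lets a
    factor be pulled out of a partial sum over variables outside its scope. *)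
Lemma nval_local net k z z' : topological net -> k < size net ->
  (forall v, v \in nsc net k -> z v = z' v) -> nval net k z = nval net k z'.
Proof.
move=> topo; elim/ltn_ind: k => k IH lt_k.
have {}IH c : c \in children (nnode net k) ->
    (forall v, v \in nsc net c -> z v = z' v) -> nval net c z = nval net c z'.
  by move=> /(topo k lt_k) lt_c; apply: IH => //; apply: ltn_trans lt_c lt_k.
rewrite /nval /nsc ninfoE // -/(nval net) -/(nsc net).
case: (nnode net k) IH => [x a|ch|ch|nu de] /= IH eq_z.
- by rewrite /leaf_val eq_z // inE.
- elim: ch IH eq_z => [|p ch IHc] IH eq_z; rewrite ?big_nil // !big_cons IHc; last 2 first.
  + by move=> c cP; apply: IH; rewrite inE cP orbT.
  + by move=> v vP; apply: eq_z; rewrite big_cons inE vP orbT.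
  congr (_ * _ + _)%Re; apply: IH; first by rewrite mem_head.
  by move=> v vP; apply: eq_z; rewrite big_cons inE vP.
- apply: eq_big_seq => c cP; apply: IH => // v vP; apply: eq_z.
  by rewrite in_bigcup_seq; apply/hasP; exists c.
congr (_ / _)%Re; apply: IH; rewrite ?inE ?eqxx ?orbT // => v vP; apply: eq_z;
  by rewrite inE vP ?orbT.
Qed.

Definition upd z x b : passign V := fun y => if y == x then Some b else z y.

Lemma eq_sum_over S (f g : passign V -> R) a :
  (forall z, (forall v, v \notin S -> z v = a v) -> f z = g z) ->
  sum_over S f a = sum_over S g a.
Proof.
by move=> fg; apply: eq_bigr => b _; apply: fg => v /negbTE ->.
Qed.

Lemma sum_over0 (f : passign V -> R) a : sum_over set0 f a = f a.
Proof.
rewrite /sum_over (big_pred1 [ffun=> false]).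
  by congr f; apply: functional_extensionality => v; rewrite inE.
move=> b; apply/forallP/eqP => [b0|-> x]; last by rewrite ffunE implybT.
by apply/ffunP=> x; move: (b0 x); rewrite inE ffunE => /negbTE.
Qed.

(** Lets the variables of a partial sum be summed out one at a time. The index set is split by the
    value at [x], and each half is reindexed by functions that are false at [x]. *)
Lemma sum_overU1 x S (f : passign V -> R) a : x \notin S ->
  sum_over (x |: S) f a =
  sum_over S (fun z => (f (upd z x false) + f (upd z x true))%Re) a.
Proof.
move=> xS; rewrite /sum_over big_split /=.
rewrite (partition_big (fun b : {ffun V -> bool} => b x) predT) //= big_bool /= Rplus_comm.
have part (v : bool) :
  \big[Rplus/R0]_(b : {ffun V -> bool} |
       [forall y, (y \notin x |: S) ==> ~~ b y] && (b x == v))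
     f (fun y => if y \in x |: S then Some (b y) else a y) =
  \big[Rplus/R0]_(b : {ffun V -> bool} | [forall y, (y \notin S) ==> ~~ b y])
     f (upd (fun y => if y \in S then Some (b y) else a y) x v).
  (* Assignments of a set are encoded by functions that are false off it. So writing [v] at [x] and
     resetting [x] to [false] are mutually inverse between the two index sets. *)
  pose put (u : bool) (b : {ffun V -> bool}) := [ffun y => if y == x then u else b y].
  rewrite (reindex_onto (put v) (put false)) => [|b /andP[_ /eqP bx]]; last first.
    by apply/ffunP=> y; rewrite !ffunE; case: eqP => // ->.
  apply: eq_big => [b|b _].
    rewrite ffunE !eqxx andbT; apply/andP/forallP => [[/forallP b0 /eqP bK] y|b0].
      move/ffunP/(_ y): bK; move: (b0 y); rewrite !inE !ffunE.
      by case: eqP => //= _ _ <-; rewrite implybT.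
    split.
      apply/forallP=> y; rewrite !inE ffunE; case: eqP => //= _; exact: b0.
    apply/eqP/ffunP=> y; rewrite !ffunE; case: eqP => // ->.
    by move: (b0 x); rewrite xS /= => /negbTE.
  congr f; apply: functional_extensionality => y; rewrite /upd !inE ffunE.
  by case: eqP.
by rewrite !part.
Qed.

Lemma sum_over1 x (f : passign V -> R) a :
  sum_over [set x] f a = (f (upd a x false) + f (upd a x true))%Re.
Proof. by rewrite -(setU0 [set x]) sum_overU1 ?inE // sum_over0. Qed.

Lemma sum_overT (f : passign V -> R) a :
  sum_over setT f a = \big[Rplus/R0]_(E : {ffun V -> bool}) f (fun x => Some (E x)).
Proof.
rewrite /sum_over; apply: eq_big => [b|b _]; first by apply/forallP=> x; rewrite inE.
by congr f; apply: functional_extensionality => v; rewrite inE.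
Qed.

End Networks.

(** * The network *)

Inductive part := PA of nat | PB of nat | PP of nat | Num | Den | Quo.

(** Transports decidable equality to [part], needed to look names up by [index]. *)
Definition part_code p : nat * nat :=
  match p with
  | PA i => (0, i) | PB i => (1, i) | PP i => (2, i)
  | Num => (3, 0) | Den => (4, 0) | Quo => (5, 0)
  end.
Definition part_decode (k : nat * nat) : part :=
  match k with
  | (0, i) => PA i | (1, i) => PB i | (2, i) => PP i
  | (3, _) => Num | (4, _) => Den | _ => Quo
  end.
Lemma part_codeK : cancel part_code part_decode. Proof. by case. Qed.
HB.instance Definition _ := Equality.copy part (can_type part_codeK).

(* [Atom x (Some a)] is (close to) the indicator of [x = a], [Atom x None] is
   uniform in [x], and [Step e t] is the conditional law of the variable [e]
   given the first [t.+1] pairs that may forbid [e = 1]. *)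
Inductive cmo (V : Type) := Atom of V & option bool | Step of V & nat | Top.
Arguments Top {V}.

Definition cmo_code V (c : cmo V) : V * option bool + option (V * nat) :=
  match c with
  | Atom x k => inl (x, k) | Step e t => inr (Some (e, t)) | Top => inr None
  end.
Definition cmo_decode V (k : V * option bool + option (V * nat)) : cmo V :=
  match k with
  | inl (x, k) => Atom x k | inr (Some (e, t)) => Step e t | inr None => Top
  end.
Lemma cmo_codeK V : cancel (@cmo_code V) (@cmo_decode V). Proof. by case. Qed.
HB.instance Definition _ (V : eqType) := Equality.copy (cmo V) (can_type (@cmo_codeK V)).

(** A symbolic address of a node: a leaf, or a part of a CMO node. Parents refer to names, and
    numerical positions are assigned only once all names are sorted. *)
Definition name (V : Type) : Type := ((V * bool) + (cmo V * part))%type.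
HB.instance Definition _ (V : eqType) := Equality.on (name V).

Record component V := Component { cw : R; cA : seq (name V); cB : seq (name V) }.

Section Construction.
Variables (V : finType) (v0 : V) (deps : V -> seq (V * V)) (rk : V -> nat).
(* With [noisy = false] both leaves of [Atom x (Some a)] test [x = a], so that
   the atom is exact; with [noisy = true] they differ, as a valid CMO node
   requires, and the atom errs with probability [eps]. *)
Variables (noisy : bool) (eps : R).
Hypothesis eps_gt0 : (0 < eps)%Re.
Hypothesis eps_lt1 : (eps < 1)%Re.
Hypothesis deps_ok : forall e p, p \in deps e ->
  [/\ p.1 != p.2, rk p.1 < rk e & rk p.2 < rk e].

Definition cquo (c : cmo V) : name V := inr (c, Quo).

(** The law of [e] after [t] pairs. [Step e t'] has already treated [t'.+1] pairs, hence the shift;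
    before any pair the law is the fair coin. *)
Definition cond_cmo e t : cmo V := if t is t'.+1 then Step e t' else Atom e None.

Definition dep e t : V * V := nth (e, e) (deps e) t.

(** [Top] has one component of weight 1 and no gates: it is the plain product of all conditional
    laws, put in CMO form so that the root can be a valid CMO node. *)
Definition comps (c : cmo V) : seq (component V) :=
  match c with
  | Atom x (Some a) =>
      [:: Component (1 - eps)%Re [::] [:: inl (x, a)];
          Component eps [::] [:: inl (x, a (+) noisy)]]
  | Atom x None =>
      [:: Component (/ 2)%Re [::] [:: inl (x, false)];
          Component (/ 2)%Re [::] [:: inl (x, true)]]
  | Step e t =>
      [seq Component (/ 4)%Re
           [:: cquo (Atom (dep e t).1 (Some p.1)); cquo (Atom (dep e t).2 (Some p.2))]
           [:: cquo (if p.1 && p.2 then Atom e (Some false) else cond_cmo e t)]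
      | p <- [:: (false, false); (false, true); (true, false); (true, true)]]
  | Top => [:: Component 1%Re [::]
                 [seq cquo (cond_cmo e (size (deps e))) | e <- enum V]]
  end.

Definition comp c i : component V := nth (Component R0 [::] [::]) (comps c) i.

Definition cmos : seq (cmo V) :=
  [seq Atom x k | x <- enum V, k <- [:: None; Some false; Some true]] ++
  [seq Step e t | e <- enum V, t <- iota 0 (size (deps e))] ++ [:: Top].

Definition crk (c : cmo V) : nat :=
  match c with
  | Atom _ _ => 0 | Step _ t => t.+1 | Top => (\max_e size (deps e)).+1
  end.

(** A CMO node occupies four levels (inner products, their product, sums, quotient), hence the
    factor 4: the quotient of a CMO of smaller [crk] lies below every part of the larger one, and
    leaves lie at 0. *)
Definition nrk (nm : name V) : nat :=
  match nm with
  | inl _ => 0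
  | inr (c, PA _) | inr (c, PB _) => (crk c * 4).+1
  | inr (c, PP _) => (crk c * 4).+2
  | inr (c, Num) | inr (c, Den) => (crk c * 4).+3
  | inr (c, Quo) => (crk c * 4).+4
  end.

Definition arity c := iota 0 (size (comps c)).

Definition parts c : seq part :=
  map PA (arity c) ++ map PB (arity c) ++ map PP (arity c) ++ [:: Num; Den; Quo].

(** Sorting by rank produces the topological order. Since duplicates are removed, each name is a
    single shared node and [idx] inverts [nth]. *)
Definition names : seq (name V) :=
  sort (relpre nrk leq)
    (undup ([seq inl (x, b) | x <- enum V, b <- [:: false; true]] ++
            [seq inr (c, p) | c <- cmos, p <- parts c])).

Definition idx (nm : name V) : nat := index nm names.

Definition body (nm : name V) : node V :=
  match nm with
  | inl (x, b) => Leaf x b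
  | inr (c, PA i) => ProdN (map idx (cA (comp c i)))
  | inr (c, PB i) => ProdN (map idx (cB (comp c i)))
  | inr (c, PP i) => ProdN [:: idx (inr (c, PA i)); idx (inr (c, PB i))]
  | inr (c, Num) => SumN [seq (cw (comp c i), idx (inr (c, PP i))) | i <- arity c]
  | inr (c, Den) => SumN [seq (cw (comp c i), idx (inr (c, PA i))) | i <- arity c]
  | inr (c, Quo) => QuotN (idx (inr (c, Num))) (idx (inr (c, Den)))
  end.

Definition net : seq (node V) := map body names.

Definition name_children (nm : name V) : seq (name V) :=
  match nm with
  | inl _ => [::]
  | inr (c, PA i) => cA (comp c i)
  | inr (c, PB i) => cB (comp c i)
  | inr (c, PP i) => [:: inr (c, PA i); inr (c, PB i)]
  | inr (c, Num) => [seq inr (c, PP i) | i <- arity c]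
  | inr (c, Den) => [seq inr (c, PA i) | i <- arity c]
  | inr (c, Quo) => [:: inr (c, Num); inr (c, Den)]
  end.

(** * Names, target variables and the topological order *)

Lemma children_body nm : children (body nm) = map idx (name_children nm).
Proof. by case: nm => [[x b]|[c []]] //=; rewrite -!map_comp. Qed.

Lemma mem_parts c p :
  (p \in parts c) = if p is (PA i | PB i | PP i) then i < size (comps c) else true.
Proof.
have mapP' (f : nat -> part) s q : injective f -> (f q \in map f s) = (q \in s).
  by move=> f_inj; apply: mem_map.
have nomap (f : nat -> part) s q : (forall i, f i != q) -> (q \in map f s) = false.
  by move=> f_q; apply/negP=> /mapP[i _ /eqP]; rewrite eq_sym (negbTE (f_q i)).
rewrite /parts /arity !mem_cat; case: p => [i|i|i|||].
- by rewrite mapP' => [|? ? []//]; rewrite !nomap // mem_iota /= !inE !orbF.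
- by rewrite mapP' => [|? ? []//]; rewrite !nomap // mem_iota /= !inE !orbF.
- by rewrite mapP' => [|? ? []//]; rewrite !nomap // mem_iota /= !inE !orbF.
- by rewrite !inE !orbT.
- by rewrite !inE !orbT.
- by rewrite !inE !orbT.
Qed.

Lemma mem_leaf x b : (inl (x, b) : name V) \in names.
Proof.
rewrite mem_sort mem_undup mem_cat; apply/orP; left.
by apply/allpairsPdep; exists x, b; rewrite mem_enum; split=> //; case: b.
Qed.

Lemma mem_inner c p :
  ((inr (c, p) : name V) \in names) = (c \in cmos) && (p \in parts c).
Proof.
rewrite mem_sort mem_undup mem_cat; apply/orP/andP => [[/allpairsPdep[x [b [_ _ //]]]|]|[cP pP]].
  by case/allpairsPdep=> c' [p' [c'P p'P [-> ->]]].
by right; apply/allpairsPdep; exists c, p.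
Qed.

Lemma atom_in x k : Atom x k \in cmos.
Proof.
rewrite mem_cat; apply/orP; left; apply/allpairsPdep.
by exists x, k; rewrite mem_enum; split=> //; case: k => [[]|].
Qed.

Lemma top_in : Top \in cmos.
Proof. by rewrite !mem_cat mem_seq1 eqxx !orbT. Qed.

Lemma step_in e t : (Step e t \in cmos) = (t < size (deps e)).
Proof.
rewrite !mem_cat mem_seq1 orbF; apply/orP/idP => [[/allpairsPdep[x [k [_ _ //]]]|]|lt_t].
  by case/allpairsPdep=> e' [t' [_ + [-> ->]]]; rewrite mem_iota.
by right; apply/allpairsPdep; exists e, t; rewrite mem_enum mem_iota.
Qed.

Lemma cond_cmo_in e t : t <= size (deps e) -> cond_cmo e t \in cmos.
Proof. by case: t => [|t] /= lt_t; [exact: atom_in | rewrite step_in]. Qed.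

Lemma crk_cond_cmo e t : crk (cond_cmo e t) = t. Proof. by case: t. Qed.

(** The variable of which the CMO node is a conditional law. [Top] is a joint law and gets the
    placeholder [v0]. *)
Definition tgt (c : cmo V) : V :=
  match c with Atom x _ => x | Step e _ => e | Top => v0 end.

Lemma tgt_cond_cmo e t : tgt (cond_cmo e t) = e. Proof. by case: t. Qed.

Definition tg (nm : name V) : V :=
  match nm with inl (x, _) => x | inr (c, _) => tgt c end.

Definition tgA c : seq V :=
  if c is Step e t then [:: (dep e t).1; (dep e t).2] else [::].
Definition tgB c : seq V := if c is Top then enum V else [:: tgt c].

Lemma size_comps_gt0 c : 0 < size (comps c).
Proof. by case: c => [x [a|]|e t|]. Qed.

(** The right-hand side does not depend on [i]: with [map_tgB], this uniformity over the components
    gives conditional completeness and the equal effective scopes of the [PB]. *)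
Lemma map_tgA c i : i < size (comps c) -> map tg (cA (comp c i)) = tgA c.
Proof.
rewrite /comp; case: c => [x [a|]|e t|] /=.
- by case: i => [|[|]].
- by case: i => [|[|]].
- by case: i => [|[|[|[|]]]].
- by case: i.
Qed.

Lemma map_tgB c i : i < size (comps c) -> map tg (cB (comp c i)) = tgB c.
Proof.
rewrite /comp; case: c => [x [a|]|e t|] /=.
- by case: i => [|[|]].
- by case: i => [|[|]].
- by case: i => [|[|[|[|]]]] //= _; rewrite tgt_cond_cmo.
- case: i => //= _; rewrite -map_comp -[RHS]map_id.
  by apply: eq_map => e /=; rewrite tgt_cond_cmo.
Qed.

(** The two gate variables of [Step e t] are distinct and of smaller rank than [e]. The disjointness
    conditions of decomposability come from here. *)
Lemma uniq_tg c : c \in cmos -> uniq (tgA c ++ tgB c).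
Proof.
case: c => [x k|e t|] //=; last by rewrite enum_uniq.
rewrite step_in => lt_t; have [] := deps_ok (mem_nth (e, e) lt_t).
rewrite -/(dep e t) => ne lt1 lt2; rewrite !inE negb_or ne /= andbT.
by apply/andP; split; apply: contraTneq isT => eq_e; move: lt1 lt2; rewrite eq_e ltnn.
Qed.

Lemma rk_tgA c x : c \in cmos -> x \in tgA c -> rk x < rk (tgt c).
Proof.
case: c => //= e t; rewrite step_in => lt_t.
by have [_ lt1 lt2] := deps_ok (mem_nth (e, e) lt_t); rewrite !inE => /orP[]/eqP->.
Qed.

Lemma cw_gt0 c i : i < size (comps c) -> (0 < cw (comp c i))%Re.
Proof.
rewrite /comp; case: c => [x [a|]|e t|] /=.
- by case: i => [|[|]] //= _; lra.
- by case: i => [|[|]] //= _; lra.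
- by case: i => [|[|[|[|]]]] //= _; lra.
- by case: i => //= _; lra.
Qed.

Lemma sum_cw c : \big[Rplus/R0]_(i <- arity c) cw (comp c i) = R1.
Proof.
by rewrite /arity /comp; case: c => [x [a|]|e t|] /=; rewrite !big_cons big_nil /=; lra.
Qed.

(** Only [Step] has gates, and they are atoms. Atoms have [crk] 0, so the bound on [crk c] puts them
    strictly before [c] in inductions. *)
Lemma cA_atom c i nm : i < size (comps c) -> nm \in cA (comp c i) ->
  exists x a, nm = cquo (Atom x (Some a)) /\ 0 < crk c.
Proof.
rewrite /comp; case: c => [x [a|]|e t|] /=.
- by case: i => [|[|]].
- by case: i => [|[|]].
- by case: i => [|[|[|[|]]]] //= _; rewrite !inE => /orP[]/eqP->; eexists; eexists.
- by case: i.
Qed.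

Lemma cB_child c i nm : c \in cmos -> i < size (comps c) -> nm \in cB (comp c i) ->
  (exists x b, nm = inl (x, b)) \/
  (exists c', [/\ nm = cquo c', c' \in cmos, c' != Top & crk c' < crk c]).
Proof.
have ntop e t : cond_cmo e t != Top by case: t.
rewrite /comp; case: c => [x [a|]|e t|] /=.
- by case: i => [|[|]] //= _ _; rewrite inE => /eqP->; left; do 2!eexists.
- by case: i => [|[|]] //= _ _; rewrite inE => /eqP->; left; do 2!eexists.
- rewrite step_in => lt_t; case: i => [|[|[|[|]]]] //= _; rewrite inE => /eqP->; right;
  eexists; split=> //; rewrite ?atom_in ?cond_cmo_in ?crk_cond_cmo //; exact: ltnW.
- move=> _; case: i => //= _ /mapP[e _ ->]; right.
  exists (cond_cmo e (size (deps e))); rewrite cond_cmo_in // crk_cond_cmo ltnS.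
  by split=> //; apply: leq_bigmax.
Qed.

Lemma name_children_ok nm nm' : nm \in names -> nm' \in name_children nm ->
  nm' \in names /\ nrk nm' < nrk nm.
Proof.
case: nm => [//|[c p]]; rewrite mem_inner => /andP[cP]; rewrite mem_parts.
have child c' : c' \in cmos -> crk c' < crk c ->
    cquo c' \in names /\ nrk (cquo c') < (crk c * 4).+1.
  move=> c'P lt_c; rewrite mem_inner c'P mem_parts; split=> //.
  by rewrite /= ltnS -[X in X <= _]/(4 + crk c' * 4) -mulSn leq_mul2r lt_c.
case: p => [i|i|i|||] /= pP.
- by case/(cA_atom pP)=> x [a [-> c_gt0]]; apply: child; rewrite ?atom_in.
- case/(cB_child cP pP)=> [[x [b ->]]|[c' [-> c'P _ lt_c]]]; last exact: child.
  by rewrite mem_leaf.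
- by rewrite !inE => /orP[]/eqP->; rewrite mem_inner cP mem_parts.
- by case/mapP=> i; rewrite mem_iota /= => iP ->; rewrite mem_inner cP mem_parts.
- case/mapP=> i; rewrite mem_iota /= => iP ->; rewrite mem_inner cP mem_parts iP.
  by split=> //; apply: leqnSn.
- by rewrite !inE => /orP[]/eqP->; rewrite mem_inner cP mem_parts.
Qed.

Lemma idx_lt nm nm' : nm \in names -> nm' \in names -> nrk nm < nrk nm' -> idx nm < idx nm'.
Proof.
move=> nmP nm'P lt_nm; rewrite ltnNge leq_eqVlt; apply/norP; split.
  apply: contraTneq lt_nm => /(congr1 (nth nm names)).
  by rewrite !nth_index // => ->; rewrite ltnn.
apply: contraTN lt_nm => lt_idx; rewrite -leqNgt.
apply: (@sorted_ltn_index _ (relpre nrk leq) _ names) lt_idx => //.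
  by move=> a b c; apply: leq_trans.
by apply: sort_sorted => a b; apply: leq_total.
Qed.

Lemma nnode_idx nm : nm \in names -> nnode net (idx nm) = body nm.
Proof. by move=> nmP; rewrite /nnode (nth_map nm) ?index_mem // nth_index. Qed.

Lemma idx_size nm : nm \in names -> idx nm < size net.
Proof. by rewrite size_map index_mem. Qed.

Lemma idxP k : k < size net -> exists2 nm, nm \in names & k = idx nm.
Proof.
rewrite size_map => lt_k; have x : name V by exact: (inl (v0, false)).
exists (nth x names k); first exact: mem_nth.
by rewrite /idx index_uniq // sort_uniq undup_uniq.
Qed.

Lemma net_topological : topological net.
Proof.
move=> k /idxP[nm nmP ->] c; rewrite nnode_idx // children_body => /mapP[nm' nm'P ->].
by have [? ?] := name_children_ok nmP nm'P; apply: idx_lt.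
Qed.

(** The quotient of [Top] has strictly the largest rank, so any other name in last position would
    have an index below that of the quotient. *)
Lemma root_net : Defs.root net = idx (cquo Top).
Proof.
have topP : cquo Top \in names by rewrite mem_inner top_in mem_parts.
have lt_top := idx_size topP.
have /idxP[nm nmP rootE] : Defs.root net < size net.
  by rewrite /Defs.root prednK // (leq_ltn_trans _ lt_top).
have [nm_top|ne] := eqVneq nm (cquo Top); first by rewrite rootE nm_top.
suff /(idx_lt nmP topP) : nrk nm < nrk (cquo Top).
  by rewrite -rootE /Defs.root; case: (size net) lt_top => // n; rewrite ltnS /= ltnNge => ->.
case: nm nmP ne {rootE} => [//|[c p]]; rewrite mem_inner => /andP[cP _] ne.
have [c_top|c_ntop] := eqVneq c Top.
  by move: ne; rewrite c_top; case: p => [i|i|i|||]; rewrite ?eqxx //= ?ltnS => _; rewrite ?leqW.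
have lt_c : crk c < crk Top.
  case: c cP c_ntop {ne} => [//|e t|]; last by rewrite eqxx.
  rewrite step_in => lt_t _.
  by rewrite /= ltnS (leq_trans lt_t) //; apply: (leq_bigmax (F := fun e => size (deps e))).
have le_c : (crk c * 4).+4 <= crk Top * 4.
  by rewrite -[X in X <= _]/(4 + crk c * 4) -mulSn leq_mul2r lt_c.
apply: leq_ltn_trans (leq_trans _ le_c) _; last exact: (leq_addl 3 _.+1).
by case: p {ne} => *; rewrite /= ?ltnS ?leqW.
Qed.

Lemma In_mem (T : eqType) (x : T) s : List.In x s -> x \in s.
Proof. by elim: s => //= y s IH [->|/IH]; rewrite inE ?eqxx // => ->; rewrite orbT. Qed.

Lemma bigcup_const (I : eqType) (s : seq I) (F : I -> {set V}) (S : {set V}) :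
  0 < size s -> (forall i, i \in s -> F i = S) -> \bigcup_(i <- s) F i = S.
Proof.
case: s => // i0 s _ FS; apply/setP=> v; rewrite in_bigcup_seq; apply/hasP/idP.
  by case=> i /FS ->.
by exists i0; rewrite ?FS ?mem_head.
Qed.

Lemma bigcup_sub_seq (I : eqType) (s : seq I) (F : I -> {set V}) (S : {set V}) :
  (forall i, i \in s -> F i \subset S) -> \bigcup_(i <- s) F i \subset S.
Proof.
by move=> FS; apply/subsetP=> v; rewrite in_bigcup_seq => /hasP[i /FS/subsetP]; apply.
Qed.

(** * Scopes *)

Definition vl nm := nval net (idx nm).
Definition ef nm := neff net (idx nm).
Definition sc nm := nsc net (idx nm).

Lemma info_idx nm : nm \in names ->
  ninfo net (idx nm) = node_info (infos net) (body nm).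
Proof.
by move=> nmP; rewrite ninfoE ?nnode_idx ?idx_size //; exact: net_topological.
Qed.

Lemma inner_in c p : c \in cmos -> p \in parts c -> (inr (c, p) : name V) \in names.
Proof. by rewrite mem_inner => -> ->. Qed.

Lemma cquo_in c : c \in cmos -> cquo c \in names.
Proof. by move=> cP; rewrite inner_in // mem_parts. Qed.

Section Equations.
Variables (c : cmo V) (i : nat).
Hypotheses (cP : c \in cmos) (iP : i < size (comps c)).
Let inP p : p \in parts c -> (inr (c, p) : name V) \in names := inner_in cP.

Lemma vl_PA z : vl (inr (c, PA i)) z = \big[Rmult/R1]_(nm <- cA (comp c i)) vl nm z.
Proof. by rewrite /vl /nval info_idx ?inP ?mem_parts //= big_map. Qed.

Lemma vl_PB z : vl (inr (c, PB i)) z = \big[Rmult/R1]_(nm <- cB (comp c i)) vl nm z.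
Proof. by rewrite /vl /nval info_idx ?inP ?mem_parts //= big_map. Qed.

Lemma vl_PP z : vl (inr (c, PP i)) z = (vl (inr (c, PA i)) z * vl (inr (c, PB i)) z)%Re.
Proof.
rewrite {1}/vl /nval info_idx ?inP ?mem_parts //= !big_cons big_nil.
by congr Rmult; rewrite Rmult_1_r.
Qed.

Lemma vl_Num z :
  vl (inr (c, Num)) z = \big[Rplus/R0]_(i <- arity c) (cw (comp c i) * vl (inr (c, PP i)) z)%Re.
Proof. by rewrite {1}/vl /nval info_idx ?inP ?mem_parts //= big_map. Qed.

Lemma vl_Den z :
  vl (inr (c, Den)) z = \big[Rplus/R0]_(i <- arity c) (cw (comp c i) * vl (inr (c, PA i)) z)%Re.
Proof. by rewrite {1}/vl /nval info_idx ?inP ?mem_parts //= big_map. Qed.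

Lemma vl_Quo z : vl (cquo c) z = (vl (inr (c, Num)) z / vl (inr (c, Den)) z)%Re.
Proof. by rewrite {1}/vl /nval info_idx ?inP ?mem_parts. Qed.

Lemma ef_PA : ef (inr (c, PA i)) = \bigcup_(nm <- cA (comp c i)) ef nm.
Proof. by rewrite /ef /neff info_idx ?inP ?mem_parts //= big_map. Qed.

Lemma ef_PB : ef (inr (c, PB i)) = \bigcup_(nm <- cB (comp c i)) ef nm.
Proof. by rewrite /ef /neff info_idx ?inP ?mem_parts //= big_map. Qed.

Lemma ef_PP : ef (inr (c, PP i)) = ef (inr (c, PA i)) :|: ef (inr (c, PB i)).
Proof. by rewrite {1}/ef /neff info_idx ?inP ?mem_parts //= !big_cons big_nil setU0. Qed.

Lemma ef_Num : ef (inr (c, Num)) = \bigcup_(i <- arity c) ef (inr (c, PP i)).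
Proof. by rewrite {1}/ef /neff info_idx ?inP ?mem_parts //= big_map. Qed.

Lemma ef_Den : ef (inr (c, Den)) = \bigcup_(i <- arity c) ef (inr (c, PA i)).
Proof. by rewrite {1}/ef /neff info_idx ?inP ?mem_parts //= big_map. Qed.

Lemma ef_Quo : ef (cquo c) = ef (inr (c, Num)) :\: ef (inr (c, Den)).
Proof. by rewrite {1}/ef /neff info_idx ?inP ?mem_parts. Qed.

Lemma sc_PA : sc (inr (c, PA i)) = \bigcup_(nm <- cA (comp c i)) sc nm.
Proof. by rewrite /sc /nsc info_idx ?inP ?mem_parts //= big_map. Qed.

Lemma sc_PB : sc (inr (c, PB i)) = \bigcup_(nm <- cB (comp c i)) sc nm.
Proof. by rewrite /sc /nsc info_idx ?inP ?mem_parts //= big_map. Qed.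

Lemma sc_PP : sc (inr (c, PP i)) = sc (inr (c, PA i)) :|: sc (inr (c, PB i)).
Proof. by rewrite {1}/sc /nsc info_idx ?inP ?mem_parts //= !big_cons big_nil setU0. Qed.

Lemma sc_Num : sc (inr (c, Num)) = \bigcup_(i <- arity c) sc (inr (c, PP i)).
Proof. by rewrite {1}/sc /nsc info_idx ?inP ?mem_parts //= big_map. Qed.

Lemma sc_Den : sc (inr (c, Den)) = \bigcup_(i <- arity c) sc (inr (c, PA i)).
Proof. by rewrite {1}/sc /nsc info_idx ?inP ?mem_parts //= big_map. Qed.

Lemma sc_Quo : sc (cquo c) = sc (inr (c, Num)) :|: sc (inr (c, Den)).
Proof. by rewrite {1}/sc /nsc info_idx ?inP ?mem_parts. Qed.

End Equations.

(** The scope invariants. For [scoped] nodes every conditioning variable has smaller rank than the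
    target, so dependency edges increase [rk]. Gates are [condfree]: they condition on nothing, so
    no dependency edge enters a [PA]. *)
Definition low x : {set V} := [set v | (v == x) || (rk v < rk x)].
Definition scoped nm := ef nm = [set tg nm] /\ sc nm \subset low (tg nm).
Definition condfree nm := ef nm = [set tg nm] /\ sc nm = [set tg nm].

Lemma condfree_scoped nm : condfree nm -> scoped nm.
Proof. by case=> efE scE; split; rewrite // scE sub1set inE eqxx. Qed.

Lemma condfree_leaf x b : condfree (inl (x, b)).
Proof. by rewrite /condfree /ef /sc /neff /nsc info_idx ?mem_leaf. Qed.

Lemma bigcup_tg s (F : name V -> {set V}) : (forall nm, nm \in s -> F nm = [set tg nm]) ->
  \bigcup_(nm <- s) F nm = [set v in map tg s].
Proof.
move=> FE; apply/setP=> v; rewrite in_bigcup_seq inE.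
apply/hasP/mapP=> [[nm nmP]|[nm nmP ->]]; first by rewrite FE // inE => /eqP->; exists nm.
by exists nm; rewrite // FE ?set11.
Qed.

Lemma arity_gt0 c : 0 < size (arity c).
Proof. by rewrite size_iota size_comps_gt0. Qed.

Lemma mem_arity c i : (i \in arity c) = (i < size (comps c)).
Proof. by rewrite mem_iota. Qed.

Lemma disj_tg c : c \in cmos -> [disjoint [set v in tgA c] & [set v in tgB c]].
Proof.
move=> /uniq_tg; rewrite cat_uniq => /and3P[_ /hasPn tgAB _].
rewrite disjoint_subset; apply/subsetP=> v; rewrite !inE => vA.
by apply: contraL vA => /tgAB.
Qed.

Section ComponentScopes.
Variable c : cmo V.
Hypothesis cP : c \in cmos.
Hypothesis A_ok : forall i nm, i < size (comps c) -> nm \in cA (comp c i) -> condfree nm.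
Hypothesis B_ok : forall i nm, i < size (comps c) -> nm \in cB (comp c i) -> scoped nm.

Lemma ef_PA_tg i : i < size (comps c) -> ef (inr (c, PA i)) = [set v in tgA c].
Proof. by move=> iP; rewrite ef_PA // -(map_tgA iP) bigcup_tg // => nm /(A_ok iP)[]. Qed.

Lemma sc_PA_tg i : i < size (comps c) -> sc (inr (c, PA i)) = [set v in tgA c].
Proof. by move=> iP; rewrite sc_PA // -(map_tgA iP) bigcup_tg // => nm /(A_ok iP)[]. Qed.

Lemma ef_PB_tg i : i < size (comps c) -> ef (inr (c, PB i)) = [set v in tgB c].
Proof. by move=> iP; rewrite ef_PB // -(map_tgB iP) bigcup_tg // => nm /(B_ok iP)[]. Qed.

Lemma ef_PP_tg i : i < size (comps c) ->
  ef (inr (c, PP i)) = [set v in tgA c] :|: [set v in tgB c].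
Proof. by move=> iP; rewrite ef_PP // ef_PA_tg // ef_PB_tg. Qed.

Lemma ef_Num_tg : ef (inr (c, Num)) = [set v in tgA c] :|: [set v in tgB c].
Proof.
by rewrite ef_Num //; apply: bigcup_const (arity_gt0 c) _ => i; rewrite mem_arity; exact: ef_PP_tg.
Qed.

Lemma ef_Den_tg : ef (inr (c, Den)) = [set v in tgA c].
Proof.
by rewrite ef_Den //; apply: bigcup_const (arity_gt0 c) _ => i; rewrite mem_arity; exact: ef_PA_tg.
Qed.

Lemma sc_Den_tg : sc (inr (c, Den)) = [set v in tgA c].
Proof.
by rewrite sc_Den //; apply: bigcup_const (arity_gt0 c) _ => i; rewrite mem_arity; exact: sc_PA_tg.
Qed.

(** The denominator carries exactly the gate variables, which are disjoint from the mixed ones, so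
    the quotient removes them and nothing else. *)
Lemma ef_Quo_tg : ef (cquo c) = [set v in tgB c].
Proof.
rewrite ef_Quo // ef_Num_tg ef_Den_tg setDUl setDv set0U.
by apply/setDidPl; rewrite disjoint_sym disj_tg.
Qed.

Lemma sc_Quo_sub (S : {set V}) : [set v in tgA c] \subset S ->
  (forall i nm, i < size (comps c) -> nm \in cB (comp c i) -> sc nm \subset S) ->
  sc (cquo c) \subset S.
Proof.
move=> AS BS; rewrite sc_Quo // sc_Den_tg subUset AS andbT sc_Num //.
apply: bigcup_sub_seq => i; rewrite mem_arity => iP.
rewrite sc_PP // sc_PA_tg // subUset AS sc_PB //.
by apply: bigcup_sub_seq => nm; exact: BS.
Qed.

End ComponentScopes.

Lemma ef_sub_sc nm : nm \in names -> ef nm \subset sc nm.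
Proof.
have [n] := ubnP (nrk nm); elim: n nm => // n IH nm lt_n nmP.
have {}IH nm' : nm' \in name_children nm -> ef nm' \subset sc nm'.
  by move=> /(name_children_ok nmP)[nm'P lt_nm]; apply: IH => //; apply: leq_trans lt_nm lt_n.
have bigS (s : seq (name V)) : (forall nm', nm' \in s -> ef nm' \subset sc nm') ->
    \bigcup_(nm' <- s) ef nm' \subset \bigcup_(nm' <- s) sc nm'.
  move=> sP; apply: bigcup_sub_seq => nm' nm'P; apply: subset_trans (sP _ nm'P) _.
  by apply/subsetP=> v vP; rewrite in_bigcup_seq; apply/hasP; exists nm'.
case: nm nmP IH {lt_n} => [[x b] _ _|[c p]].
  by have [-> ->] := condfree_leaf x b.
rewrite mem_inner mem_parts => /andP[cP]; case: p => [i|i|i|||] /= pP IH.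
- by rewrite ef_PA // sc_PA // bigS.
- by rewrite ef_PB // sc_PB // bigS.
- by rewrite ef_PP // sc_PP // setUSS ?IH // !inE eqxx ?orbT.
- by rewrite ef_Num // sc_Num //; move: (bigS _ IH); rewrite !big_map.
- by rewrite ef_Den // sc_Den //; move: (bigS _ IH); rewrite !big_map.
rewrite ef_Quo // sc_Quo //; apply: subset_trans (subsetUl _ _).
by apply: subset_trans (subsetDl _ _) (IH _ _); rewrite mem_head.
Qed.

(** Induction on [crk], with all three claims at once. Gates are atoms, hence [condfree]. A CMO
    other than [Top] adds to its target only gate variables of smaller rank and the scopes of mixed
    children with the same target, so it is [scoped]. *)
Lemma scopes c : c \in cmos ->
  [/\ ef (cquo c) = [set v in tgB c],
      c != Top -> scoped (cquo c) &
      crk c = 0 -> condfree (cquo c)].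
Proof.
have [n] := ubnP (crk c); elim: n c => // n IH c lt_n cP.
have A_ok i nm : i < size (comps c) -> nm \in cA (comp c i) -> condfree nm.
  move=> iP /(cA_atom iP)[x [a [-> c_gt0]]].
  by have [|_ _] := IH (Atom x (Some a)) (leq_trans c_gt0 lt_n); [exact: atom_in | exact].
have B_ok i nm : i < size (comps c) -> nm \in cB (comp c i) -> scoped nm.
  move=> iP /(cB_child cP iP)[[x [b ->]]|[c' [-> c'P c'_ntop lt_c]]].
    by apply/condfree_scoped/condfree_leaf.
  by have [_ + _] := IH c' (leq_trans lt_c lt_n) c'P; apply.
have efE := ef_Quo_tg cP A_ok B_ok; split=> [//|c_ntop|c0].
  have tgBE : tgB c = [:: tgt c] by case: c c_ntop {lt_n cP A_ok B_ok efE} => // /eqP.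
  split; first by rewrite efE tgBE; apply/setP=> v; rewrite !inE.
  apply: (sc_Quo_sub cP A_ok) => [|i nm iP nmP].
    by apply/subsetP=> v; rewrite !inE => /(rk_tgA cP) ->; rewrite orbT.
  have : tg nm \in tgB c by rewrite -(map_tgB iP) map_f.
  by rewrite tgBE inE => /eqP tgE; have [_] := B_ok i nm iP nmP; rewrite tgE.
have [x [k cE]] : exists x k, c = Atom x k.
  by case: c c0 {lt_n cP A_ok B_ok efE} => // x k _; exists x, k.
have efx : ef (cquo c) = [set tgt c] by rewrite efE cE; apply/setP=> v; rewrite !inE.
split=> //; apply/eqP; rewrite eqEsubset; apply/andP; split; last first.
  by rewrite -[[set _]]efx ef_sub_sc ?cquo_in.
apply: (sc_Quo_sub cP A_ok) => [|i nm iP nmP].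
  by apply/subsetP=> v; rewrite cE inE.
have [[y [b nmE]]|[c' [_ _ _]]] := cB_child cP iP nmP; last by rewrite c0.
have : tg nm \in tgB c by rewrite -(map_tgB iP) map_f.
rewrite cE inE => /eqP tgE; rewrite [tg (cquo _)]/= -[x]tgE nmE.
by have [_ ->] := condfree_leaf y b.
Qed.

Lemma cA_condfree c i nm : i < size (comps c) -> nm \in cA (comp c i) -> condfree nm.
Proof. by move=> iP /(cA_atom iP)[x [a [-> _]]]; have [_ _] := scopes (atom_in x (Some a)); apply. Qed.

Lemma cB_scoped c : c \in cmos ->
  forall i nm, i < size (comps c) -> nm \in cB (comp c i) -> scoped nm.
Proof.
move=> cP i nm iP /(cB_child cP iP)[[x [b ->]]|[c' [-> c'P c'_ntop _]]].
  by apply/condfree_scoped/condfree_leaf.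
by have [_ + _] := scopes c'P; apply.
Qed.

Lemma child_in c i nm : c \in cmos -> i < size (comps c) ->
  nm \in cA (comp c i) ++ cB (comp c i) -> nm \in names.
Proof.
move=> cP iP; rewrite mem_cat => /orP[/(cA_atom iP)[x [a [-> _]]]|].
  by rewrite cquo_in ?atom_in.
move=> /(cB_child cP iP)[[x [b ->]]|[c' [-> c'P _ _]]]; first exact: mem_leaf.
exact: cquo_in.
Qed.

(** Effective scopes are singletons of distinct targets. An edge into a child starts at a target
    that the child conditions on, hence at one of smaller rank, so [rk] of the target increases
    along edges. *)
Lemma decomposable_list s : (forall nm, nm \in s -> scoped nm) -> uniq (map tg s) ->
  (forall i j, i < size (map idx s) -> j < size (map idx s) -> i != j ->
     [disjoint neff net (nth 0 (map idx s) i) & neff net (nth 0 (map idx s) j)]) /\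
  acyclic (@dep_graph V net (map idx s)).
Proof.
move=> s_ok s_uniq; pose nm0 : name V := inl (v0, false); split.
  rewrite size_map => i j iP jP ne; rewrite !(nth_map nm0) // -/(ef _) -/(ef _).
  have [-> _] := s_ok _ (mem_nth nm0 iP); have [-> _] := s_ok _ (mem_nth nm0 jP).
  rewrite disjoints1 inE -!(nth_map nm0 v0 tg) //.
  by rewrite nth_uniq ?size_map.
apply: (@acyclic_incr _ _ (fun i : 'I__ => rk (tg (nth nm0 s i)))) => i j.
have iP : i < size s by rewrite -(size_map idx).
have jP : j < size s by rewrite -(size_map idx).
rewrite /dep_graph !(nth_map nm0) // /ncond -/(ef _) -/(ef _) -/(sc _).
have [-> _] := s_ok _ (mem_nth nm0 iP); have [-> /subsetP low_j] := s_ok _ (mem_nth nm0 jP).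
rewrite disjoints1 negbK !inE => /andP[/negbTE ne /low_j].
by rewrite inE ne.
Qed.

(** * Values and soundness *)

Lemma vl_local nm z z' : nm \in names -> (forall v, v \in sc nm -> z v = z' v) ->
  vl nm z = vl nm z'.
Proof. by move=> nmP; apply: nval_local net_topological (idx_size nmP). Qed.

Lemma vl_leaf x b z : vl (inl (x, b)) z = leaf_val x b z.
Proof. by rewrite /vl /nval info_idx ?mem_leaf. Qed.

Lemma vl_Atom x k z : vl (cquo (Atom x k)) z =
  if k is Some a then ((1 - eps) * leaf_val x a z + eps * leaf_val x (a (+) noisy) z)%Re
  else (/ 2 * leaf_val x false z + / 2 * leaf_val x true z)%Re.
Proof.
have cP := atom_in x k; rewrite vl_Quo // vl_Num // vl_Den // /arity /comp.
case: k cP => [a|] cP; rewrite [comps _]/= [iota _ _]/= !big_cons !big_nil;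
  rewrite !vl_PP // !vl_PB // !vl_PA // /comp /= !big_cons !big_nil !vl_leaf; field; lra.
Qed.

Lemma vl_Den_Step e t z : t < size (deps e) ->
  vl (inr (Step e t, Den)) z = (/ 4 *
    (vl (cquo (Atom (dep e t).1 (Some false))) z + vl (cquo (Atom (dep e t).1 (Some true))) z) *
    (vl (cquo (Atom (dep e t).2 (Some false))) z + vl (cquo (Atom (dep e t).2 (Some true))) z))%Re.
Proof.
rewrite -step_in => cP; rewrite vl_Den // /arity [comps _]/= [iota _ _]/= !big_cons !big_nil.
by rewrite !vl_PA // /comp /= !big_cons !big_nil; field.
Qed.

(** Three of the four components carry the same mixed node. The form isolates the denominator times
    that node, plus a correction for the component in which both gates test [true]. *)
Lemma vl_Num_Step e t z : t < size (deps e) ->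
  vl (inr (Step e t, Num)) z = (/ 4 *
    ((vl (cquo (Atom (dep e t).1 (Some false))) z + vl (cquo (Atom (dep e t).1 (Some true))) z) *
     (vl (cquo (Atom (dep e t).2 (Some false))) z + vl (cquo (Atom (dep e t).2 (Some true))) z) *
     vl (cquo (cond_cmo e t)) z +
     vl (cquo (Atom (dep e t).1 (Some true))) z * vl (cquo (Atom (dep e t).2 (Some true))) z *
     (vl (cquo (Atom e (Some false))) z - vl (cquo (cond_cmo e t)) z)))%Re.
Proof.
rewrite -step_in => cP; rewrite vl_Num // /arity [comps _]/= [iota _ _]/= !big_cons !big_nil.
by rewrite !vl_PP // !vl_PA // !vl_PB // /comp /= !big_cons !big_nil; field.
Qed.

(** For [Step] the denominator factors into sums of two atoms testing opposite values of one
    variable, and such a sum is positive even where one atom vanishes. Without gates the denominator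
    is a sum of weights. *)
Lemma vl_Den_gt0 c z : c \in cmos -> (0 < vl (inr (c, Den)) z)%Re.
Proof.
have atom_gt0 x : (0 < vl (cquo (Atom x (Some false))) z + vl (cquo (Atom x (Some true))) z)%Re.
  rewrite !vl_Atom /leaf_val; case: (z x) => [[]|]; case: noisy => /=; lra.
case: c => [x k|e t|] cP.
- rewrite vl_Den // /arity /comp; case: k cP => [a|] cP;
  by rewrite [comps _]/= [iota _ _]/= !big_cons !big_nil !vl_PA // /comp /= !big_nil; lra.
- rewrite vl_Den_Step -?step_in //; apply: Rmult_lt_0_compat => //.
  by apply: Rmult_lt_0_compat => //; lra.
- rewrite vl_Den // /arity [comps _]/= [iota _ _]/= !big_cons !big_nil.
  by rewrite !vl_PA // /comp /= !big_nil; lra.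
Qed.

Definition normal nm :=
  forall z, (vl nm (upd z (tg nm) false) + vl nm (upd z (tg nm) true) = 1)%Re.

Lemma normal_leaf x b : normal (inl (x, b)).
Proof. by move=> z; rewrite !vl_leaf /leaf_val /upd /= eqxx; case: b => /=; lra. Qed.

(* Summing out a variable of maximal rank first leaves the other factors
   unchanged. *)
Lemma sum_over_prod s a :
  (forall nm, nm \in s -> [/\ nm \in names, scoped nm & normal nm]) -> uniq (map tg s) ->
  sum_over [set v in map tg s] (fun z => \big[Rmult/R1]_(nm <- s) vl nm z) a = R1.
Proof.
pose geq_rk := relpre (fun nm : name V => rk (tg nm)) geq.
have geq_total : total geq_rk by move=> x y; rewrite /= orbC; apply: leq_total.
have geq_trans : transitive geq_rk by move=> x y z /= le1 le2; apply: leq_trans le2 le1.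
move=> s_ok s_uniq; have sE := permEl (perm_sort geq_rk s).
have -> : [set v in map tg s] = [set v in map tg (sort geq_rk s)].
  by apply/setP=> v; rewrite !inE (perm_mem (perm_map tg sE)).
rewrite (@eq_sum_over _ _ _ (fun z => \big[Rmult/R1]_(nm <- sort geq_rk s) vl nm z)); last first.
  by move=> z _; apply/esym/perm_big.
have {s_ok} : forall nm, nm \in sort geq_rk s -> [/\ nm \in names, scoped nm & normal nm].
  by move=> nm; rewrite mem_sort; apply: s_ok.
have {s_uniq} : uniq (map tg (sort geq_rk s)) by rewrite (perm_uniq (perm_map tg sE)).
have : sorted geq_rk (sort geq_rk s) by apply: sort_sorted.
elim: (sort geq_rk s) => {s sE} [|nm s IH].
  move=> _ _ _; have -> : [set v in map tg ([::] : seq (name V))] = set0.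
    by apply/setP=> v; rewrite !inE.
  by rewrite sum_over0 big_nil.
rewrite /sorted (path_sortedE geq_trans) => /andP[/allP ge_nm s_sorted].
rewrite [uniq _]/= => /andP[nm_s s_uniq] s_ok.
have -> : [set v in map tg (nm :: s)] = tg nm |: [set v in map tg s].
  by apply/setP=> v; rewrite !inE.
have [_ _ nm_normal] := s_ok nm (mem_head _ _).
rewrite sum_overU1 ?inE //.
rewrite -[RHS](IH s_sorted s_uniq) => [|nm' nm'P]; last by apply: s_ok; rewrite inE nm'P orbT.
apply: eq_sum_over => z _; rewrite !big_cons.
have keep b : \big[Rmult/R1]_(nm' <- s) vl nm' (upd z (tg nm) b) =
              \big[Rmult/R1]_(nm' <- s) vl nm' z.
  apply: eq_big_seq => nm' nm'P.
  have [nm'_in [_ /subsetP nm'_low] _] : [/\ nm' \in names, scoped nm' & normal nm'].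
    by apply: s_ok; rewrite inE nm'P orbT.
  apply: vl_local => // v /nm'_low; rewrite inE /upd; have [->|//] := eqVneq v (tg nm).
  case/orP=> [/eqP tgE|lt_rk].
    by move: nm_s; rewrite tgE map_f.
  by have := ge_nm nm' nm'P; rewrite /= leqNgt lt_rk.
by rewrite !keep -Rmult_plus_distr_r nm_normal Rmult_1_l.
Qed.

Section Marginals.
Variable c : cmo V.
Hypothesis cP : c \in cmos.
Hypothesis B_normal : forall i nm, i < size (comps c) -> nm \in cB (comp c i) -> normal nm.

(** The products [PA] do not read the summed variables and come out of the sum, and each product
    [PB] of normal factors sums to 1. What remains is the denominator; this is conditional
    soundness. *)
Lemma sum_over_Num a :
  sum_over [set v in tgB c] (vl (inr (c, Num))) a = vl (inr (c, Den)) a.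
Proof.
rewrite (@eq_sum_over _ _ _ (fun z => \big[Rplus/R0]_(i <- arity c)
   (cw (comp c i) * vl (inr (c, PA i)) a * vl (inr (c, PB i)) z)%Re)); last first.
  move=> z zE; rewrite vl_Num //; apply: eq_big_seq => i; rewrite mem_arity => iP.
  rewrite vl_PP // Rmult_assoc (@vl_local _ z a) ?inner_in ?mem_parts // => v.
  rewrite (sc_PA_tg cP (@cA_condfree c)) // => vA; apply: zE.
  by rewrite (disjointFr (disj_tg cP) vA).
rewrite /sum_over exchange_big /= vl_Den //; apply: eq_big_seq => i; rewrite mem_arity => iP.
rewrite -big_distrr /=.
transitivity (cw (comp c i) * vl (inr (c, PA i)) a *
              sum_over [set v in tgB c] (vl (inr (c, PB i))) a)%Re => //.
rewrite (@eq_sum_over _ _ _ (fun z => \big[Rmult/R1]_(nm <- cB (comp c i)) vl nm z)); last first.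
  by move=> z _; rewrite vl_PB.
rewrite -(map_tgB iP) sum_over_prod ?Rmult_1_r // => [nm nmP|].
  split; [|exact: (cB_scoped cP iP)|exact: B_normal iP nmP].
  by apply: (child_in cP iP); rewrite mem_cat nmP orbT.
by have := uniq_tg cP; rewrite (map_tgB iP) cat_uniq => /and3P[].
Qed.

Lemma sum_over_Quo a : sum_over [set v in tgB c] (vl (cquo c)) a = R1.
Proof.
rewrite (@eq_sum_over _ _ _ (fun z => vl (inr (c, Num)) z * / vl (inr (c, Den)) a)%Re).
  rewrite /sum_over -big_distrl /=.
  rewrite -[X in (X * _)%Re]/(sum_over [set v in tgB c] (vl (inr (c, Num))) a) sum_over_Num.
  by apply: Rinv_r; apply: Rgt_not_eq; apply: vl_Den_gt0.
move=> z zE; rewrite vl_Quo //; congr (_ * / _)%Re.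
apply: vl_local => [|v]; first by rewrite inner_in ?mem_parts.
rewrite (sc_Den_tg cP (@cA_condfree c)) => vA; apply: zE.
by rewrite (disjointFr (disj_tg cP) vA).
Qed.

End Marginals.

(** Discharges [B_normal] by induction on [crk]: a mixed child that is not a leaf is a CMO with a
    single mixed variable, and [sum_over_Quo] normalises it once its own mixed children are
    normal. *)
Lemma cB_normal c i nm : c \in cmos -> i < size (comps c) -> nm \in cB (comp c i) -> normal nm.
Proof.
have [n] := ubnP (crk c); elim: n c i nm => // n IH c i nm lt_n cP iP /(cB_child cP iP).
case=> [[x [b ->]]|[c' [-> c'P c'_ntop lt_c]]]; first exact: normal_leaf.
move=> z; rewrite -sum_over1.
have -> : [set tg (cquo c')] = [set v in tgB c'].
  by case: (c') c'_ntop => [x k|e t|/eqP//] *; apply/setP=> v; rewrite !inE.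
apply: (sum_over_Quo c'P) => j nm' jP nm'P; exact: IH (leq_trans lt_c lt_n) c'P jP nm'P.
Qed.

(** * Well-formedness, completeness, decomposability, soundness and CMO validity *)

Lemma net_wf : spqn_wf net.
Proof.
split=> [|k kP].
  by move: (idx_size (cquo_in top_in)); case: net.
split=> [c cP|ch]; first exact: net_topological kP c cP.
have [nm nmP ->] := idxP kP; rewrite nnode_idx //.
case: nm nmP => [[]//|[c []]] //=; rewrite mem_inner => /andP[cP _] [<-].
  rewrite big_map sum_cw; split=> // p /List.in_map_iff[i [<-]] /In_mem.
  by rewrite mem_arity => /cw_gt0.
rewrite big_map sum_cw; split=> // p /List.in_map_iff[i [<-]] /In_mem.
by rewrite mem_arity => /cw_gt0.
Qed.

Lemma net_cond_complete : cond_complete net.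
Proof.
move=> k /idxP[nm nmP ->] ch; rewrite nnode_idx //.
case: nm nmP => [[]//|[c []]] //=; rewrite mem_inner => /andP[cP _] [<-] p q.
  move=> /List.in_map_iff[i [<-]] /In_mem iP /List.in_map_iff[j [<-]] /In_mem jP.
  rewrite -![neff _ _]/(ef _); move: iP jP; rewrite !mem_arity => iP jP.
  by rewrite !(ef_PP_tg cP (@cA_condfree c) (cB_scoped cP)).
move=> /List.in_map_iff[i [<-]] /In_mem iP /List.in_map_iff[j [<-]] /In_mem jP.
rewrite -![neff _ _]/(ef _); move: iP jP; rewrite !mem_arity => iP jP.
by rewrite !(ef_PA_tg cP (@cA_condfree c)).
Qed.

Lemma ncond_PA c i : c \in cmos -> i < size (comps c) ->
  ncond net (idx (inr (c, PA i))) = set0.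
Proof.
move=> cP iP; rewrite /ncond -/(sc _) -/(ef _).
by rewrite (sc_PA_tg cP (@cA_condfree c)) // (ef_PA_tg cP (@cA_condfree c)) // setDv.
Qed.

Lemma net_cond_decomposable : cond_decomposable net.
Proof.
move=> k /idxP[nm nmP ->] ch; rewrite nnode_idx //.
case: nm nmP => [[]//|[c []]] //= i; rewrite mem_inner mem_parts => /andP[cP iP] [<-].
- apply: decomposable_list => [nm /(cA_condfree iP)/condfree_scoped //|].
  by rewrite map_tgA //; have := uniq_tg cP; rewrite cat_uniq => /and3P[].
- apply: decomposable_list => [nm /(cB_scoped cP iP) //|].
  by rewrite map_tgB //; have := uniq_tg cP; rewrite cat_uniq => /and3P[].
split; last first.
  (* In the product of [PA] and [PB], at positions 0 and 1, the only possible edge goes from 0 to 1: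
     [PA] conditions on nothing, and no child conditions on its own effective scope. *)
  apply: (@acyclic_incr _ _ (@nat_of_ord _)) => -[[|[|//]] ?] [[|[|//]] ?] //;
    rewrite /dep_graph /=.
  - by rewrite ncond_PA // disjoint_sym disjoints_subset sub0set.
  - by rewrite ncond_PA // disjoint_sym disjoints_subset sub0set.
  rewrite disjoints_subset; apply: contraNT => _; apply/subsetP=> v.
  by rewrite /ncond !inE => ->.
have AB : [disjoint neff net (idx (inr (c, PA i))) & neff net (idx (inr (c, PB i)))].
  rewrite -/(ef _) -/(ef _).
  by rewrite (ef_PA_tg cP (@cA_condfree c)) // (ef_PB_tg cP (cB_scoped cP)) // disj_tg.
case=> [|[|?]] [|[|?]] i1 i2 ne; try discriminate; first exact: AB.
by rewrite disjoint_sym; exact: AB.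
Qed.

Lemma net_cond_sound : cond_sound net.
Proof.
move=> k /idxP[nm nmP ->] nu de; rewrite nnode_idx //.
case: nm nmP => [[]//|[c []]] //=; rewrite mem_inner => /andP[cP _] [<- <-].
have efD := ef_Den_tg cP (@cA_condfree c).
have efN := ef_Num_tg cP (@cA_condfree c) (cB_scoped cP).
have efQ := ef_Quo_tg cP (@cA_condfree c) (cB_scoped cP).
rewrite /ncond -!/(ef _) -!/(sc _); split; first by move=> a; apply: vl_Den_gt0.
rewrite (sc_Den_tg cP (@cA_condfree c)) efD setDv sub0set efN subsetUl; do 2!split=> //.
move=> a; rewrite efQ; apply/esym/(sum_over_Num cP) => i nm; exact: cB_normal.
Qed.

Lemma leaf_child c i x b : i < size (comps c) -> inl (x, b) \in cB (comp c i) ->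
  exists y k, c = Atom y k.
Proof.
rewrite /comp; case: c => [y k|e t|] /=; first by exists y, k.
  by case: i => [|[|[|[|]]]] //= _; rewrite inE.
by case: i => //= _ /mapP[].
Qed.

(** Induction on [crk]: atoms are base CMO nodes and all others are recursive ones. [noisy] makes
    the two leaves of an exact-value atom test opposite values, as the base case demands. *)
Lemma net_valid c : noisy -> c \in cmos -> valid_cmo net (idx (cquo c)).
Proof.
move=> noisyP; have [n] := ubnP (crk c); elim: n c => // n IH c lt_n cP.
have nthA (T : Type) (x : T) (f : nat -> T) i : i < size (comps c) ->
    nth x [seq f j | j <- arity c] i = f i.
  by move=> iP; rewrite (nth_map 0) ?size_iota // nth_iota.
have shape : cmo_shape net (idx (cquo c)) (size (tgA c)) (size (tgB c)) (size (comps c))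
    [seq cw (comp c i) | i <- arity c] (idx (inr (c, Num))) (idx (inr (c, Den)))
    [seq idx (inr (c, PP i)) | i <- arity c] [seq idx (inr (c, PA i)) | i <- arity c]
    [seq idx (inr (c, PB i)) | i <- arity c]
    [seq map idx (cA (comp c i)) | i <- arity c] [seq map idx (cB (comp c i)) | i <- arity c].
  rewrite /cmo_shape !size_map size_iota size_comps_gt0; split.
    (* For [Top], [beta] is the number of variables, positive because [v0] exists. *)
    by case: (c) => //=; rewrite -cardE; apply/card_gt0P; exists v0.
  do 7!split=> //; split.
    by move=> i iP; rewrite !nthA // -(map_tgA iP) -(map_tgB iP) !size_map.
  split; first by move=> w /List.in_map_iff[i [<-]] /In_mem; rewrite mem_arity => /cw_gt0.
  split; first by rewrite big_map sum_cw.
  rewrite !zip_map !nnode_idx ?inner_in ?mem_parts //; do 3!split=> //.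
  move=> i iP; rewrite !nthA //.
  by rewrite !nnode_idx ?inner_in ?mem_parts.
have conds : cmo_conds net (size (comps c)) (idx (inr (c, Num))) (idx (inr (c, Den)))
    [seq idx (inr (c, PP i)) | i <- arity c] [seq idx (inr (c, PA i)) | i <- arity c]
    [seq idx (inr (c, PB i)) | i <- arity c].
  do 2!(split; first by apply/net_cond_complete/idx_size; rewrite inner_in ?mem_parts).
  split=> [i iP|i j iP jP]; rewrite !nthA //; last first.
    by rewrite -!/(ef _) !(ef_PB_tg cP (cB_scoped cP)).
  rewrite ncond_PA // disjoint_sym disjoints_subset sub0set.
  by do 3!(split; first by apply/net_cond_decomposable/idx_size; rewrite inner_in ?mem_parts).
have [[x [k cE]]|c_natom] : (exists x k, c = Atom x k) \/ (forall x k, c != Atom x k).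
- by case: (c) => [x k|e t|]; [left; exists x, k|right|right].
- have size2 : size (comps c) = 2 by rewrite cE; case: (k).
  have [sizeA sizeB] : size (tgA c) = 0 /\ size (tgB c) = 1 by rewrite cE.
  rewrite sizeA sizeB size2 in shape; rewrite size2 in conds.
  apply: (VCmoBase (x := x) shape conds).
  rewrite !nthA ?size2 // cE.
  (* The first leaf tests [a] and the second its negation, so the value of [a] decides the order of
     the two indicators. *)
  rewrite /comp; case: (k) => [a|] /=; rewrite !nnode_idx ?mem_leaf //=; last by left.
  by rewrite noisyP addbT; case: a; [right|left].
apply: VCmoRec shape conds _ _ => i j iP jP; rewrite nthA // (nth_map (inl (v0, false))).
- have : nth (inl (v0, false)) (cA (comp c i)) j \in cA (comp c i).
    by rewrite mem_nth // -(size_map tg) map_tgA.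
  case/(cA_atom iP)=> x [a [-> c_gt0]]; apply: IH (atom_in _ _).
  exact: leq_trans c_gt0 lt_n.
- by rewrite -(size_map tg) map_tgA.
- have : nth (inl (v0, false)) (cB (comp c i)) j \in cB (comp c i).
    by rewrite mem_nth // -(size_map tg) map_tgB.
  move=> nmP; move: (nmP); case: (cB_child cP iP nmP) => [[x [b ->]]|[c' [-> c'P _ lt_c]] _].
    by case/(leaf_child iP)=> y [k cE]; have := c_natom y k; rewrite cE eqxx.
  by apply: IH c'P; apply: leq_trans lt_c lt_n.
- by rewrite -(size_map tg) map_tgB.
Qed.

(** * Values on total assignments *)

(** The error probability of an atom. If not [noisy], both leaves are the same indicator, so the
    weights [1 - eps] and [eps] add up and [eps] disappears. *)
Definition noise : R := if noisy then eps else R0.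

Definition total (E : {ffun V -> bool}) : passign V := fun x => Some (E x).

Definition atom_prob (r : R) (b a : bool) : R := if b == a then (1 - r)%Re else r.

(** One stage as a mixture: [g] is the probability that both gates read 1, in which case the law is
    the atom of value 0; otherwise the previous law [q] is kept. *)
Definition step_prob (r : R) (E : {ffun V -> bool}) e (q : R) (p : V * V) : R :=
  let g := (atom_prob r (E p.1) true * atom_prob r (E p.2) true)%Re in
  (g * atom_prob r (E e) false + (1 - g) * q)%Re.

Definition cond_prob r E e t : R := foldl (step_prob r E e) (/ 2)%Re (take t (deps e)).

Definition joint r E : R := \big[Rmult/R1]_(e : V) cond_prob r E e (size (deps e)).

Lemma vl_Atom_total E x a :
  vl (cquo (Atom x (Some a))) (total E) = atom_prob noise (E x) a.
Proof.
rewrite vl_Atom /leaf_val /atom_prob /noise /=.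
by case: (E x); case: a; case: noisy => /=; lra.
Qed.

(** On a total assignment opposite atoms sum to 1, so the denominator is 1/4 and cancels the
    component weights: each [Step] performs one [step_prob]. *)
Lemma vl_cond_cmo_total E e t : t <= size (deps e) ->
  vl (cquo (cond_cmo e t)) (total E) = cond_prob noise E e t.
Proof.
elim: t => [|t IH] lt_t.
  by rewrite vl_Atom /leaf_val /cond_prob take0 /=; case: (E e) => /=; lra.
have atoms1 x : (atom_prob noise (E x) false + atom_prob noise (E x) true = 1)%Re.
  by rewrite /atom_prob; case: (E x) => /=; lra.
rewrite /cond_prob (take_nth (e, e) lt_t) -cats1 foldl_cat -/(cond_prob noise E e t) /=.
rewrite vl_Quo ?step_in // vl_Num_Step // vl_Den_Step // IH ?(ltnW lt_t) //.
by rewrite !vl_Atom_total !atoms1 /step_prob -/(dep e t); field.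
Qed.

Lemma Psi_total E : Psi net (total E) = joint noise E.
Proof.
rewrite /Psi root_net -/(vl _) vl_Quo ?top_in // vl_Num ?top_in // vl_Den ?top_in //.
rewrite /arity [comps _]/= [iota _ _]/= !big_cons !big_nil.
rewrite vl_PP ?top_in // vl_PB ?top_in // !vl_PA ?top_in // /comp /= big_nil big_map.
rewrite (eq_big_seq _ (fun e _ => vl_cond_cmo_total E (leqnn (size (deps e))))).
have -> X : ((1 * (R1 * X) + R0) / (1 * R1 + R0))%Re = X by field.
by rewrite /joint -big_enum.
Qed.

(** The mixed variables of [Top] are all the variables, so normalisation of its quotient is
    normalisation of the whole output. *)
Lemma sum_Psi : \big[Rplus/R0]_(E : {ffun V -> bool}) Psi net (total E) = R1.
Proof.
rewrite -(sum_overT _ (fun=> None)) /Psi root_net -/(vl _).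
have -> : [set: V] = [set v in tgB Top] by apply/setP=> v; rewrite !inE mem_enum.
by apply: (sum_over_Quo top_in) => i nm; apply: cB_normal top_in.
Qed.

(** A CMO node has at most 4 components, hence at most [3 * 4 + 3 = 15] parts. Each variable brings
    2 leaves, 3 atoms and at most [m] steps, giving [2 + 45 + 15 * m]; the last 15 is [Top]. *)
Lemma size_net m : (forall e, size (deps e) <= m) -> spqn_size net <= #|V| * (15 * m + 47) + 15.
Proof.
move=> le_m; apply: leq_trans (count_size _ _) _; rewrite size_map size_sort.
apply: leq_trans (size_undup _) _; rewrite size_cat.
have size_parts c : size (parts c) <= 15.
  by rewrite !size_cat !size_map /arity !size_iota; case: c => [x [a|]|e t|].
have size_dep (S T : Type) (U : S -> Type) (f : forall x, U x -> T) (s : seq S)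
    (t : forall x, seq (U x)) n :
    (forall x, size (t x) <= n) -> size [seq f x y | x <- s, y <- t x] <= size s * n.
  move=> le_n; elim: s => //= x s IH; rewrite size_cat size_map mulSn.
  exact: leq_add (le_n x) IH.
have size_cmos : size cmos <= #|V| * (m + 3) + 1.
  rewrite !size_cat addnA -[size [:: Top]]/1 leq_add2r addnC mulnDr cardE; apply: leq_add.
    by apply: size_dep => e; rewrite size_iota.
  by apply: (size_dep _ _ _ _ _ (fun=> [:: None; Some false; Some true])).
apply: leq_trans (leq_add (size_dep _ _ _ _ _ _ 2 _) (size_dep _ _ _ _ _ _ 15 size_parts)) _ => //.
rewrite -cardE; apply: leq_trans (leq_add (leqnn _) (leq_mul size_cmos (leqnn 15))) _.
rewrite mulnDl addnA leq_add2r -mulnA -mulnDr leq_mul2l; apply/orP; right.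
by rewrite mulnDl addnC -addnA mulnC.
Qed.

End Construction.

(** * Vanishing noise and the support of the limit law *)

Section Limits.
Variable V : finType.
Variable deps : V -> seq (V * V).
Implicit Types (E : {ffun V -> bool}) (r : nat -> R).

Lemma Un_cv_const c : Un_cv (fun _ => c) c.
Proof. by move=> e e_gt0; exists 0%nat => n _; rewrite R_dist_eq. Qed.

Lemma atom_prob_cv r l b a : Un_cv r l -> Un_cv (fun n => atom_prob (r n) b a) (atom_prob l b a).
Proof. by move=> rl; rewrite /atom_prob; case: eqP => // _; apply: CV_minus (Un_cv_const _) rl. Qed.

(** The initial value also varies with [n], because each step of the fold replaces it by another
    convergent sequence. *)
Lemma foldl_step_cv r l E e s q ql : Un_cv r l -> Un_cv q ql ->
  Un_cv (fun n => foldl (step_prob (r n) E e) (q n) s) (foldl (step_prob l E e) ql s).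
Proof.
move=> rl; elim: s q ql => //= p s IH q ql qP; apply: (IH (fun n => step_prob _ _ _ _ _)).
have gP := CV_mult _ _ _ _ (atom_prob_cv (E p.1) true rl) (atom_prob_cv (E p.2) true rl).
apply: CV_plus; first exact: CV_mult gP (atom_prob_cv _ _ rl).
by apply: CV_mult qP; apply: CV_minus gP; apply: Un_cv_const.
Qed.

Lemma joint_cv r l E : Un_cv r l -> Un_cv (fun n => joint deps (r n) E) (joint deps l E).
Proof.
move=> rl; rewrite /joint; elim: (index_enum V) => [|e s IH].
  by rewrite big_nil; apply: Un_cv_ext (Un_cv_const _) => n; rewrite big_nil.
rewrite big_cons; apply: (@Un_cv_ext (fun n => Rmult _ _)) => [n|].
  by rewrite big_cons; reflexivity.
by apply: CV_mult IH; apply: foldl_step_cv rl (Un_cv_const _).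
Qed.

Definition forbidden E e := has (fun p => E p.1 && E p.2) (deps e).

(** Without noise the mixing weight is 0 or 1: a pair with both variables set overwrites the law by
    the indicator of value 0, and later pairs either keep it or overwrite it by the same one. *)
Lemma cond_prob0 E e : cond_prob deps 0 E e (size (deps e)) =
  if forbidden E e then if E e then R0 else R1 else (/ 2)%Re.
Proof.
rewrite /cond_prob take_size /forbidden; elim: (deps e) (/ 2)%Re => //= p s IH q.
rewrite IH /step_prob /atom_prob /=.
by case: (E p.1); case: (E p.2); case: (E e); case: (has _ s) => //=; lra.
Qed.

Lemma joint0_gt0 E : (0 < joint deps 0 E)%Re <-> forall e, ~~ (E e && forbidden E e).
Proof.
split=> [joint_gt0 e|allowed].
  apply/negP=> /andP[Ee forb]; move: joint_gt0.
  rewrite /joint (bigD1 e) //= cond_prob0 forb Ee Rmult_0_l; exact: Rlt_irrefl.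
apply: prodR_gt0 => e _; rewrite cond_prob0; move: (allowed e).
by case: (E e); case: (forbidden E e) => //= _; lra.
Qed.

Lemma joint0_ge0 E : (0 <= joint deps 0 E)%Re.
Proof.
rewrite /joint; elim/big_ind: _ => [|x y|e _]; [lra|exact: Rmult_le_pos|].
by rewrite cond_prob0; case: (forbidden E e); case: (E e); lra.
Qed.

End Limits.

(** * Triangles *)

Section Triangles.
Variable M : nat.

(** For [e] joining j < k, the pairs of edges ij and ik that would close a triangle with [e]. The
    partial [insub] discards every [i] that is not below both endpoints. *)
Definition edge_deps (e : edge M) : seq (edge M * edge M) :=
  pmap (fun i : 'I_M =>
          if (insub (i, (val e).1), insub (i, (val e).2)) is (Some x, Some y)
          then Some (x, y) else None) (enum 'I_M).

(** The smaller endpoint: ij and ik both have rank i, below the rank j of the edge jk. *)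
Definition edge_rk (e : edge M) : nat := (val e).1.

Lemma mem_edge_deps e x y :
  reflect (exists i : 'I_M, val x = (i, (val e).1) /\ val y = (i, (val e).2))
    ((x, y) \in edge_deps e).
Proof.
rewrite mem_pmap; apply: (iffP mapP) => [[i _]|[i [xE yE]]]; last first.
  by exists i; rewrite ?mem_enum // -xE -yE !valK.
case: insubP => // x' _ x'E; case: insubP => // y' _ y'E [-> ->].
by exists i.
Qed.

Lemma edge_deps_ok e p : p \in edge_deps e ->
  [/\ p.1 != p.2, edge_rk p.1 < edge_rk e & edge_rk p.2 < edge_rk e].
Proof.
case: p => x y /mem_edge_deps[i [xE yE]].
change [/\ x != y, (val x).1 < (val e).1 & (val y).1 < (val e).1].
have := valP x; rewrite xE yE => lt_i; split=> //.
apply: contraTneq (valP e) => xy; move: xE; rewrite xy yE => -[->].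
by rewrite ltnn.
Qed.

Lemma size_edge_deps e : size (edge_deps e) <= M.
Proof. by rewrite size_pmap (leq_trans (count_size _ _)) // size_enum_ord. Qed.

Lemma card_edge : #|edge M| <= M * M.
Proof. by rewrite -[M in M * M]card_ord -card_prod; apply: leq_card val_inj. Qed.

(** A triangle i < j < k is detected at its edge jk, through the pair of edges that meet at the
    smallest vertex i. *)
Lemma triangle_freeP (E : {ffun edge M -> bool}) :
  triangle_free E <-> forall e, ~~ (E e && forbidden edge_deps E e).
Proof.
split=> [tf e|allowed]; last first.
  apply/existsP=> -[i] /existsP[j] /existsP[k] /and5P[ij jk].
  case/existsP=> x /andP[/eqP xE Ex] /existsP[e /andP[/eqP eE Ee]] /existsP[y /andP[/eqP yE Ey]].
  move/negP: (allowed e); apply; rewrite Ee; apply/hasP; exists (x, y); last by rewrite /= Ex.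
  by apply/mem_edge_deps; exists i; rewrite eE.
apply: contra tf => /andP[Ee /hasP[[x y] /mem_edge_deps[i [xE yE]] /= /andP[Ex Ey]]].
apply/existsP; exists i; apply/existsP; exists (val e).1; apply/existsP; exists (val e).2.
have := valP x; rewrite xE => /= ->; rewrite (valP e) /=.
apply/and3P; split; apply/existsP; [exists x|exists e|exists y].
- by rewrite xE eqxx.
- by rewrite -surjective_pairing eqxx.
- by rewrite yE eqxx.
Qed.

Hypothesis M_gt1 : 2 <= M.

Definition edge0 : edge M := exist _ (Ordinal (ltnW M_gt1), Ordinal M_gt1) isT.

Definition spqn noisy eps := net edge_deps noisy eps.

(** There are at most [M * M] edges with at most [M] pairs each, so [size_net] gives three terms of
    degree 3, 2 and 0, with coefficients 15, 47 and 15; each is bounded by its coefficient times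
    [M ^ 4]. *)
Lemma size_spqn noisy eps : spqn_size (spqn noisy eps) <= 77 * M ^ 4.
Proof.
have M_gt0 : 0 < M := ltnW M_gt1.
apply: leq_trans (size_net _ _ size_edge_deps) _.
apply: leq_trans (leq_add (leq_mul card_edge (leqnn _)) (leqnn _)) _.
rewrite mulnDr (_ : 77 = 15 + 47 + 15) // !mulnDl; apply: leq_add; first apply: leq_add.
- by rewrite mulnCA leq_mul2l /= -[M * M]/(M ^ 2) -expnSr leq_pexp2l.
- by rewrite mulnC leq_mul2l /= -[M * M]/(M ^ 2) leq_pexp2l.
- by rewrite -{1}(muln1 15) leq_mul2l /= expn_gt0 M_gt0.
Qed.

Lemma joint_tf : tf_distribution (joint edge_deps 0).
Proof.
split; [exact: joint0_ge0|split=> [|E]]; last by rewrite joint0_gt0 triangle_freeP.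
(* The limit law is the output of the exact network, whose [noise] is 0 for every weight, so it
   inherits total mass 1. *)
rewrite -(sum_Psi edge0 false (/ 2) edge_deps_ok).
by apply: eq_bigr => E _; rewrite (Psi_total edge0).
Qed.

End Triangles.

Theorem theorem3 :
  (exists C : nat, forall M : nat, 2 <= M ->
     exists net : seq (node (edge M)),
       spqn_wf net /\ spqn_size net <= C * M ^ 4 /\
       cond_complete net /\ cond_decomposable net /\ cond_sound net /\
       exists d : {ffun edge M -> bool} -> R,
         tf_distribution d /\
         forall E : {ffun edge M -> bool}, Psi net (fun x => Some (E x)) = d E)
  /\
  (exists C : nat, forall M : nat, 2 <= M ->
     exists d : {ffun edge M -> bool} -> R,
       tf_distribution d /\
       exists nets : nat -> seq (node (edge M)),
         (forall n, composed_of_cmo (nets n) /\ spqn_size (nets n) <= C * M ^ 4) /\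
         forall E : {ffun edge M -> bool},
           Un_cv (fun n => Psi (nets n) (fun x => Some (E x))) (d E)).
Proof.
split; exists 77 => M M_gt1; pose e0 := edge0 M_gt1; have dep := @edge_deps_ok M.
  have [e_gt0 e_lt1] : (0 < / 2 < 1)%Re by lra.
  exists (spqn M false (/ 2)%Re).
  split; first exact: (net_wf e0).
  split; first exact: size_spqn.
  split; first exact: (net_cond_complete e0 dep).
  split; first exact: (net_cond_decomposable e0 dep).
  split; first exact: (net_cond_sound e0 dep).
  exists (joint (@edge_deps M) 0); split; first exact: joint_tf.
  exact: (Psi_total e0 _ false).
(* [RinvN n] is 1/(n+1); halving it keeps the weight below 1 already at [n = 0]. *)
pose eps n := (/ 2 * RinvN n)%Re.
have eps_bounds n : (0 < eps n < 1)%Re.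
  rewrite /eps /=; have n_ge0 := pos_INR n.
  have : (0 < / (INR n + 1) <= 1)%Re.
    split; first by apply: Rinv_0_lt_compat; lra.
    by rewrite -[X in (_ <= X)%Re]Rinv_1; apply: Rinv_le_contravar; lra.
  by lra.
exists (joint (@edge_deps M) 0); split; first exact: joint_tf.
exists (fun n => spqn M true (eps n)); split=> [n|E].
  have [e_gt0 e_lt1] := eps_bounds n.
  split; last exact: size_spqn.
  split; first exact: (net_wf e0).
  by rewrite (root_net e0); apply: (net_valid e0 e_gt0 e_lt1 dep); rewrite ?top_in.
apply: (@Un_cv_ext (fun n => joint (@edge_deps M) (eps n) E)) => [n|].
  by rewrite (Psi_total e0).
(* The limit 0 is written as [/ 2 * 0] to match the product form of [eps]. *)
apply: joint_cv; rewrite -(Rmult_0_r (/ 2)); apply: CV_mult RinvN_cv.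
exact: Un_cv_const.
Qed.
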